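(* Let $f\colon X\rightarrow Y$ be a continuous surjection between compact Hausdorff spaces. Then $f$ is semi-open if and only if $2^f\colon 2^X\rightarrow 2^Y$ is semi-open.
   Context: For a compact Hausdorff space $X$, the hyperspace $2^X$ is the collection of all non-empty closed subsets of $X$ equipped with the Vietoris topology, a base of which is formed by the sets $\langle U_1,\dotsc,U_n\rangle:=\{K\in 2^X\mid K\subseteq U_1\cup\dotsm\cup U_n,\ K\cap U_i\neq\emptyset,\ 1\le i\le n\}$ for all $n\ge 1$ and all non-empty open sets $U_1,\dotsc,U_n$ in $X$. A continuous surjection $f\colon X\to Y$ of compact Hausdorff spaces induces the continuous surjection $2^f\colon 2^X\to 2^Y$, $K\mapsto f[K]$. A continuous surjection $g\colon A\to B$ of topological spaces is semi-open if for every non-empty open subset $U$ of $A$, the interior of $g[U]$ in $B$ is non-empty. *)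

(* Defs.v *)
From HB Require Import structures.
From mathcomp Require Import all_boot all_classical topology.

Set Implicit Arguments.
Unset Strict Implicit.
Unset Printing Implicit Defensive.

Local Open Scope classical_set_scope.

Record hyperspace (X : topologicalType) := Hyperspace {
  hyper_set :> set X;
  hyper_closed : closed hyper_set;
  hyper_neq0 : hyper_set !=set0 }.

HB.instance Definition _ (X : topologicalType) := gen_eqMixin (hyperspace X).
HB.instance Definition _ (X : topologicalType) :=
  gen_choiceMixin (hyperspace X).

Lemma hyperspaceP (X : topologicalType) (K L : hyperspace X) :
  K = L <-> (K : set X) = L.
Proof.
split=> [->//|]; case: K L => [K cK K0] [L cL L0] /= KL.
by subst L; rewrite (Prop_irrelevance cK cL) (Prop_irrelevance K0 L0).
Qed.

(* [vietoris Us] is <U_1, ..., U_n> for [Us] the list of the open sets U_i. *)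
Definition vietoris_index (X : topologicalType) : set (seq (set X)) :=
  [set Us | Us != [::] /\ forall U, U \in Us -> open U /\ U !=set0].

Definition vietoris (X : topologicalType) (Us : seq (set X)) :
    set (hyperspace X) :=
  [set K : hyperspace X | (K : set X) `<=` \bigcup_(U in [set` Us]) U /\
    forall U, U \in Us -> K `&` U !=set0].

Section vietoris_topology.
Context {X : topologicalType}.
Implicit Types (Us Vs : seq (set X)) (K : hyperspace X).

Lemma vietoris_cover :
  \bigcup_(Us in @vietoris_index X) vietoris Us = [set: hyperspace X].
Proof.
apply/seteqP; split=> // K _; have [x Kx] := hyper_neq0 K.
exists [:: setT]; split=> //.
- by move=> U; rewrite inE => /eqP ->; split; [exact: openT|exists x].
- by move=> y _; exists setT => //=; rewrite inE.
- by move=> U; rewrite inE => /eqP ->; exists x.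
Qed.

Lemma open_bigcup_index Us :
  vietoris_index Us -> open (\bigcup_(U in [set` Us]) U).
Proof. by move=> [_ oU]; apply: bigcup_open => U /oU[]. Qed.

Lemma vietoris_join Us Vs K : vietoris_index Us -> vietoris_index Vs ->
  vietoris Us K -> vietoris Vs K ->
  exists Ws, [/\ vietoris_index Ws, vietoris Ws K &
    vietoris Ws `<=` vietoris Us `&` vietoris Vs].
Proof.
move=> DU DV [KU UK] [KV VK].
set UU := \bigcup_(U in [set` Us]) U; set VV := \bigcup_(V in [set` Vs]) V.
have [[U0 oU] [V0 oV]] := (DU, DV).
have oUU : open UU by exact: open_bigcup_index.
have oVV : open VV by exact: open_bigcup_index.
exists ([seq U `&` VV | U <- Us] ++ [seq V `&` UU | V <- Vs]); split.
- split; first by case: (Us) U0.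
  move=> W; rewrite mem_cat => /orP[] /mapP[U UUs ->]; split.
  + by apply: openI => //; case: (oU _ UUs).
  + by have [x [Kx Ux]] := UK _ UUs; exists x; split=> //; exact: KV.
  + by apply: openI => //; case: (oV _ UUs).
  + by have [x [Kx Ux]] := VK _ UUs; exists x; split=> //; exact: KU.
- split.
  + move=> x Kx; have [U UUs Ux] := KU _ Kx; exists (U `&` VV).
      by rewrite /= mem_cat (map_f (fun V => V `&` VV) UUs).
    by split=> //; exact: KV.
  + move=> W; rewrite mem_cat => /orP[] /mapP[U UUs ->].
    * by have [x [Kx Ux]] := UK _ UUs; exists x; split=> //; split=> //; exact: KV.
    * by have [x [Kx Ux]] := VK _ UUs; exists x; split=> //; split=> //; exact: KU.
- move=> L [LW WL]; have LUV x : (L : set X) x -> UU x /\ VV x.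
    move=> /LW[W]; rewrite /= mem_cat => /orP[] /mapP[U UUs ->] [Ux Vx].
      by split=> //; exists U.
    by split=> //; exists U.
  split; split; try by move=> x /LUV[].
  + move=> U UUs; have [|x [Lx [Ux _]]] := WL (U `&` VV); last by exists x.
    by rewrite mem_cat (map_f (fun V => V `&` VV) UUs).
  + move=> U UUs; have [|x [Lx [Ux _]]] := WL (U `&` UU); last by exists x.
    by rewrite mem_cat (map_f (fun V => V `&` UU) UUs) orbT.
Qed.

End vietoris_topology.

(* Bases of topologies are required to be indexed by a pointed type. *)
HB.instance Definition _ (T : choiceType) := isPointed.Build (seq T) [::].

HB.instance Definition _ (X : topologicalType) :=
  isBaseTopological.Build (hyperspace X)
    (@vietoris_cover X) (@vietoris_join X).

Lemma open_hyperspaceE (X : topologicalType) (W : set (hyperspace X)) :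
  open W <-> forall K, W K ->
    exists Us, [/\ vietoris_index Us, vietoris Us K & vietoris Us `<=` W].
Proof.
split.
  case=> D sD <- K [Us DUs UsK]; exists Us; split=> //; first exact: sD.
  by move=> L UsL; exists Us.
move=> oW; exists [set Us | vietoris_index Us /\ vietoris Us `<=` W].
  by move=> Us [].
apply/seteqP; split=> [K [Us [_ UsW] /UsW//]|K /oW[Us [? ? ?]]].
by exists Us.
Qed.

Lemma vietoris_basis (X : topologicalType) :
  basis [set vietoris Us | Us in @vietoris_index X].
Proof.
split=> [_ [Us DUs <-]|K W].
  by apply/open_hyperspaceE => L UsL; exists Us; split.
rewrite nbhsE => -[V [/open_hyperspaceE oV VK] VW].
have [Us [DUs UsK UsV]] := oV _ VK.
by exists (vietoris Us); [split=> //; exists Us|exact: subset_trans VW].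
Qed.

Section hyperspace_map.
Context {X Y : topologicalType} (f : X -> Y).
Hypotheses (cX : compact [set: X]) (hY : hausdorff_space Y).
Hypothesis cf : continuous f.

Lemma closed_image_hyperspace (K : hyperspace X) : closed (f @` K).
Proof.
apply: compact_closed => //; apply: continuous_compact.
  exact: continuous_subspaceT.
by apply: subclosed_compact cX _ => //; exact: hyper_closed.
Qed.

Lemma image_hyperspace_neq0 (K : hyperspace X) : f @` K !=set0.
Proof. by have [x Kx] := hyper_neq0 K; exists (f x); exists x. Qed.

Definition hyperspace_map (K : hyperspace X) : hyperspace Y :=
  Hyperspace (@closed_image_hyperspace K) (image_hyperspace_neq0 K).

Lemma hyperspace_map_continuous : continuous hyperspace_map.
Proof.
apply/continuousP => W /open_hyperspaceE oW; apply/open_hyperspaceE => K WK.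
have [Us [[U0 oU] [KU UK] UsW]] := oW _ WK.
exists [seq f @^-1` U | U <- Us]; split.
- split; first by case: (Us) U0.
  move=> _ /mapP[U UUs ->]; split; first by move/continuousP: cf; apply; case: (oU _ UUs).
  by have [_ [[x Kx <-] Ux]] := UK _ UUs; exists x.
- split=> [x Kx|_ /mapP[U UUs ->]].
    have [|U UUs Ux] := KU (f x); first by exists x.
    by exists (f @^-1` U) => //=; exact: (map_f (fun V => f @^-1` V) UUs).
  by have [_ [[x Kx <-] Ux]] := UK _ UUs; exists x.
- move=> L [LU UL]; apply: UsW; split=> [_ [x Lx <-]|U UUs].
    by have [_ /mapP[U UUs ->] Ux] := LU _ Lx; exists U.
  have [|x [Lx Ux]] := UL (f @^-1` U); first exact: (map_f (fun V => f @^-1` V) UUs).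
  by exists (f x); split=> //; exists x.
Qed.

Lemma hyperspace_map_surj : set_surj [set: X] [set: Y] f ->
  set_surj [set: hyperspace X] [set: hyperspace Y] hyperspace_map.
Proof.
move=> sf L _.
have cK : closed (f @^-1` L).
  by move/continuous_closedP: cf; apply; exact: hyper_closed.
have K0 : f @^-1` L !=set0.
  have [y Ly] := hyper_neq0 L; have [x _ fx] := sf y I.
  by exists x; rewrite /= fx.
exists (Hyperspace cK K0) => //; apply/hyperspaceP => /=.
apply/seteqP; split=> [_ [x Lx <-]//|y Ly].
by have [x _ fx] := sf y I; exists x => //=; rewrite fx.
Qed.

End hyperspace_map.

(* Only used for continuous surjections [g]; for [hyperspace_map] this is
   ensured by [hyperspace_map_continuous] and [hyperspace_map_surj]. *)
Definition semi_open (A B : topologicalType) (g : A -> B) :=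
  forall U : set A, open U -> U !=set0 -> (g @` U)° !=set0.

(* Main.v *)
Require Import Defs.
From mathcomp Require Import all_boot all_classical topology.

Local Open Scope classical_set_scope.

(** Forward: given <U_1, ..., U_n>, shrink each U_i to a nonempty open U_i' with
    closure inside U_i and put V_i := int f[U_i'].  Every L in <V_1, ..., V_n>
    is the image of the union of the sets cl(U_i') /\ f^-1[L], which is closed
    thanks to the shrinking and belongs to <U_1, ..., U_n>.
    Backward: if <V_1, ..., V_n> lies in the image of <U> under 2^f, then adding
    a point of V_i to a member of <V_1, ..., V_n> shows V_i to be a part of
    f[U]. *)

Lemma open_vietoris (X : topologicalType) (Us : seq (set X)) :
  vietoris_index Us -> open (vietoris Us).
Proof. by move=> DUs; apply: (vietoris_basis X).1; exists Us. Qed.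

(** Picking one point from each set of the list gives a finite non-empty set, which is closed since
    [X] is Hausdorff. *)
Lemma vietoris_neq0 (X : topologicalType) (Us : seq (set X)) :
  hausdorff_space X -> vietoris_index Us -> vietoris Us !=set0.
Proof.
move=> hX [Us0 oUs].
(* [x0] is a dummy value: the choice function [c] must also be defined at empty sets. *)
have [x0 _] : [set: X] !=set0.
  case: Us Us0 oUs => // U Us _ oUs.
  by have [|_ [x _]] := oUs U; [rewrite mem_head|exists x].
have /choice[c cP] : forall U : set X, exists x, U !=set0 -> U x.
  move=> U; have [[x Ux]|U0] := pselect (U !=set0); first by exists x.
  by exists x0 => /U0.
have cUs U : U \in Us -> U (c U) by move=> /oUs[_ /cP].
have closed_c : closed [set` map c Us].
  by apply: compact_closed => //; apply: finite_compact; exact: finite_seq.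
have c_neq0 : [set` map c Us] !=set0.
  by case: (Us) Us0 => // U Vs _; exists (c U); rewrite /= mem_head.
exists (Hyperspace closed_c c_neq0); split=> [_ /mapP[U UUs ->]|U UUs].
  by exists U => //; exact: cUs.
by exists (c U); split; [exact: map_f|exact: cUs].
Qed.

(** Compact Hausdorff spaces are regular: a point of [U] has a neighbourhood [A] with closure inside
    [U], and the interior of [A] serves as [V]. *)
Lemma shrink_open (X : topologicalType) (U : set X) :
  compact [set: X] -> hausdorff_space X -> open U -> U !=set0 ->
  exists V, [/\ open V, V !=set0 & closure V `<=` U].
Proof.
move=> cX hX oU [x Ux].
have [||A xA AU] := compact_regular (x := x) hX cX _ (t := U).
- exact: filterT.
- exact: open_nbhs_nbhs.
exists A°; split; first exact: open_interior.
  by exists x.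
by apply: subset_trans AU; apply: closureS; exact: interior_subset.
Qed.

Section semi_open_hyperspace_map.
Context {X Y : topologicalType} (f : X -> Y).
Hypotheses (cX : compact [set: X]) (hX : hausdorff_space X).
Hypotheses (hY : hausdorff_space Y) (cf : continuous f).

Lemma semi_open_hyperspace_map :
  semi_open f -> semi_open (hyperspace_map cX hY cf).
Proof.
move=> sof W /open_hyperspaceE oW [K0 /oW[Us [[Us0 oUs] _ UsW]]].
have /choice[s sP] : forall U : set X, exists V, open U -> U !=set0 ->
    [/\ open V, V !=set0 & closure V `<=` U].
  move=> U; have [[oU U0]|nU] := pselect (open U /\ U !=set0).
    by have [V VP] := shrink_open X U cX hX oU U0; exists V.
  by exists set0 => oU U0; case: nU.
pose v U := (f @` s U)°.
have sUs U : U \in Us -> [/\ open (s U), s U !=set0 & closure (s U) `<=` U].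
  by move=> /oUs[/sP].
have Dv : vietoris_index (map v Us).
  split; first by case: (Us) Us0.
  move=> _ /mapP[U /sUs[osU sU0 _] ->]; split; first exact: open_interior.
  exact: sof.
have [L0 vL0] := vietoris_neq0 _ _ hY Dv.
(* Non-emptiness of the interior reduces to placing a whole non-empty basic open set inside the
   image. *)
exists L0; suff: vietoris (map v Us) `<=` (hyperspace_map cX hY cf @` W)°.
  exact.
rewrite -open_subsetE; last exact: open_vietoris.
move=> L [Lv vL].
pose K := \bigcup_(U in [set` Us]) (closure (s U) `&` f @^-1` L).
(* These lifts serve three times: [K] is non-empty, [K] meets every [U] of the list, and [f] maps
   [K] onto all of [L]. *)
have lift U y : U \in Us -> v U y -> (L : set Y) y ->
    exists x, [/\ s U x, f x = y & K x].
  move=> UUs /interior_subset[x sx <-] Lfx; exists x; split=> //.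
  by exists U => //; split=> //; exact: subset_closure.
have cK : closed K.
  apply: closed_bigcup; first exact: finite_seq.
  move=> U _; apply: closedI; first exact: closed_closure.
  by move/continuous_closedP: cf; apply; exact: hyper_closed.
have K_neq0 : K !=set0.
  have [y Ly] := hyper_neq0 L; have [_ /mapP[U UUs ->] vy] := Lv _ Ly.
  by have [x [_ _ Kx]] := lift _ _ UUs vy Ly; exists x.
exists (Hyperspace cK K_neq0).
  apply: UsW; split=> [x [U UUs [sx _]]|U UUs].
    by exists U => //; have [_ _] := sUs _ UUs; apply.
  have [y [Ly vy]] := vL _ (map_f v UUs).
  have [x [sx _ Kx]] := lift _ _ UUs vy Ly.
  exists x; split=> //; have [_ _] := sUs _ UUs; apply.
  exact: subset_closure.
apply/hyperspaceP; apply/seteqP; split=> [_ [x [U _ [_ Lfx]] <-] //|y Ly].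
have [_ /mapP[U UUs ->] vy] := Lv _ Ly.
by have [x [_ fx Kx]] := lift _ _ UUs vy Ly; exists x.
Qed.

Lemma semi_open_of_hyperspace_map :
  semi_open (hyperspace_map cX hY cf) -> semi_open f.
Proof.
move=> so2f U oU U0.
have DU : vietoris_index [:: U].
  by split=> // V; rewrite inE => /eqP ->.
have [L] := so2f _ (open_vietoris _ _ DU) (vietoris_neq0 _ _ hX DU).
(* The interior point [L] has a basic neighbourhood, given by [Vs], inside the image. *)
have /open_hyperspaceE/[apply] := open_interior (hyperspace_map cX hY cf @` vietoris [:: U]).
move=> [Vs [[Vs0 oVs] [LV VL] VsU]].
have [y Ly] := hyper_neq0 L.
have [V VVs Vy] := LV _ Ly.
exists y; suff: V `<=` (f @` U)° by exact.
rewrite -open_subsetE; last by have [] := oVs _ VVs.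
move=> z Vz.
have cLz : closed ((L : set Y) `|` [set z]).
  apply: closedU; first exact: hyper_closed.
  by apply: compact_closed => //; exact: compact_set1.
have Lz_neq0 : (L : set Y) `|` [set z] !=set0 by exists z; right.
(* Adding [z] preserves membership: [z] is covered by [V], and [L] already meets every set of [Vs].
   So the enlarged set is the image of some [K] inside [U], and [z] has a preimage there. *)
have /VsU/interior_subset[K [KU _] /hyperspaceP /= KLz] :
    vietoris Vs (Hyperspace cLz Lz_neq0).
  split=> [x [/LV//|->]|V' /VL[x [Lx V'x]]]; first by exists V.
  by exists x; split=> //; left.
have : (f @` K) z by rewrite KLz; right.
move=> [x Kx <-]; exists x => //.
by have [V' /=] := KU _ Kx; rewrite inE => /eqP ->.
Qed.

End semi_open_hyperspace_map.

Theorem theorem4 (X Y : topologicalType) (f : X -> Y)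
    (cX : compact [set: X]) (hX : hausdorff_space X)
    (cY : compact [set: Y]) (hY : hausdorff_space Y)
    (cf : continuous f) (sf : set_surj [set: X] [set: Y] f) :
  semi_open f <-> semi_open (hyperspace_map cX hY cf).
Proof.
split; first exact: (semi_open_hyperspace_map f cX hX hY cf).
exact: (semi_open_of_hyperspace_map f cX hX hY cf).
Qed.
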